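(* Let $m,n,p\in\mathbb N$ be standard and $\alpha,\beta\in\mathbb E$. (1) Let $\mathcal A=(\alpha_{ij}),\mathcal B=(\beta_{ij})\in\mathcal M_{m,n}(\mathbb E)$. If either $R(\alpha)\le\min_{1\le i\le m,\,1\le j\le n}\max\{R(\alpha_{ij}),R(\beta_{ij})\}$ or $\mathcal A,\mathcal B$ are not nearly opposite, then $\alpha(\mathcal A+\mathcal B)=\alpha\mathcal A+\alpha\mathcal B$. (2) Let $\mathcal A=(\alpha_{ij})\in\mathcal M_{m,n}(\mathbb E)$. If either $\max_{1\le i\le m,\,1\le j\le n}R(\alpha_{ij})\le\max\{R(\alpha),R(\beta)\}$ or $\alpha,\beta$ are not nearly opposite, then $(\alpha+\beta)\mathcal A=\alpha\mathcal A+\beta\mathcal A$. (3) Let $\mathcal A=(\alpha_{ij})\in\mathcal M_{m,n}(\mathbb E)$ and $\mathcal B=(\beta_{ij}),\mathcal C=(\gamma_{ij})\in\mathcal M_{n,p}(\mathbb E)$. If either $\max_{1\le i\le m,\,1\le j\le n}R(\alpha_{ij})\le\min_{1\le i\le n,\,1\le j\le p}\max\{R(\beta_{ij}),R(\gamma_{ij})\}$ or $\mathcal B,\mathcal C$ are not nearly opposite, then $\mathcal A(\mathcal B+\mathcal C)=\mathcal A\mathcal B+\mathcal A\mathcal C$.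
   Context: We work in nonstandard analysis with external sets (the theory HST of Kanovei and Reeken, extending a bounded form of Nelson's IST), so $\mathbb R$ contains nonstandard numbers. A neutrix is a convex additive subgroup of $\mathbb R$ (possibly an external set), e.g. $\oslash$, the set of all infinitesimals. Neutrices are ordered by inclusion ($\le$, max, min of neutrices refer to inclusion). An external number is a set $\alpha=a+A=\{a+x: x\in A\}$ with $a\in\mathbb R$ and $A=N(\alpha)$ a neutrix; $\mathbb E$ is the class of external numbers. $\alpha$ is zeroless if $0\notin\alpha$; otherwise $\alpha$ is a neutrix. Operations are Minkowski operations: $(a+A)\pm(b+B)=(a\pm b)+(A+B)$, $(a+A)(b+B)=ab+aB+bA+AB$, $1/(a+A)=1/a+A/a^2$ for $a+A$ zeroless. The relative uncertainty is the neutrix $R(\alpha)=N(\alpha)/\alpha$ if $\alpha$ is zeroless (this equals $A/a$), and $R(\alpha)=\mathbb R$ otherwise. Two zeroless external numbers $\alpha,\beta$ are nearly opposite if $\alpha/\beta\subseteq-1+\oslash$ (a pair containing a neutrix is not nearly opposite). Two matrices $(\alpha_{ij}),(\beta_{ij})$ of the same size are not nearly opposite if for all $i,j$ the numbers $\alpha_{ij},\beta_{ij}$ are not nearly opposite. $\mathcal M_{m,n}(\mathbb E)$ is the class of $m\times n$ matrices over $\mathbb E$; addition, scalar multiplication and product are defined by the usual formulas. *)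

(* Defs.v *)
From HB Require Import structures.
From mathcomp Require Import all_boot all_order all_algebra.
From mathcomp Require Import boolp classical_sets reals num_normedtype.
From mathcomp Require Import ring lra.

Set Implicit Arguments.
Unset Strict Implicit.
Unset Printing Implicit Defensive.

Import Order.TTheory GRing.Theory Num.Theory.

Local Open Scope classical_set_scope.
Local Open Scope ring_scope.

(* The nonstandard real line is an [R : rcfType] together with an embedding   *)
(* [st : {rmorphism R0 -> R}] of the standard reals [R0 : realType]. As both  *)
(* are real closed, [st] is automatically an elementary embedding for the     *)
(* language of ordered fields. External sets are arbitrary elements of        *)
(* [set R], and standard natural numbers are the elements of [nat].           *)

(* There is an unlimited, hence a nonstandard, real number. *)
Definition has_nonstandard (R0 : realType) (R : rcfType)
    (st : {rmorphism R0 -> R}) : Prop :=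
  exists w : R, forall x : R0, st x < w.

Definition infinitesimals (R0 : realType) (R : rcfType)
    (st : {rmorphism R0 -> R}) : set R :=
  [set x | forall e : R0, 0 < e -> `|x| < st e].

Record neutrix (R : realFieldType) := Neutrix {
  nset :> set R;
  neutrix0 : nset 0;
  neutrixB : forall x y, nset x -> nset y -> nset (x - y);
  neutrix_convex : is_interval nset }.

Section NeutrixTheory.
Variable R : realFieldType.
Implicit Types (A B C : neutrix R) (x y a : R).

Lemma neutrix_inj A B : nset A = nset B -> A = B.
Proof.
case: A B => [A a0 aB ac] [B b0 bB bc] /= eqAB; subst B.
by congr Neutrix; exact: Prop_irrelevance.
Qed.

Lemma neutrixN A x : nset A x -> nset A (- x).
Proof. by move=> Ax; rewrite -sub0r; apply: neutrixB => //; exact: neutrix0. Qed.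

Lemma neutrixD A x y : nset A x -> nset A y -> nset A (x + y).
Proof.
by move=> Ax Ay; rewrite -[y]opprK; apply: neutrixB => //; exact: neutrixN.
Qed.

Lemma neutrix_norm A x : nset A x -> nset A `|x|.
Proof. by move=> Ax; case: (ger0P x) => // _; exact: neutrixN. Qed.

Lemma neutrix_le A x y : nset A x -> `|y| <= `|x| -> nset A y.
Proof.
move=> /neutrix_norm Ax; rewrite ler_norml => xy.
exact: (neutrix_convex (neutrixN Ax) Ax xy).
Qed.

Lemma neutrix_lt A a x : ~ nset A a -> nset A x -> `|x| < `|a|.
Proof. by move=> Aa Ax; rewrite ltNge; apply/negP => /(neutrix_le Ax). Qed.

Fact is_interval_dom (S : set R) : S 0 ->
  (forall x y, S x -> S y -> S (x - y)) ->
  (forall x y, S x -> `|y| <= `|x| -> S y) -> is_interval S.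
Proof.
move=> S0 SB Sd x y Sx Sy z /andP[xz zy].
have [z0|z0] := lerP 0 z.
  by apply: (Sd y) => //; rewrite !ger0_norm ?(le_trans z0 zy).
by apply: (Sd x) => //; rewrite !ltr0_norm ?lerN2 // (le_lt_trans xz z0).
Qed.

Fact nzero_convex : is_interval [set 0 : R].
Proof.
by move=> x y -> -> z /andP[z0 z1]; apply/eqP; rewrite eq_le z0 z1.
Qed.

Fact nzeroB (x y : R) : [set 0 : R] x -> [set 0 : R] y -> [set 0 : R] (x - y).
Proof. by move=> -> ->; rewrite subrr. Qed.

Definition nzero : neutrix R := Neutrix (erefl : [set 0 : R] 0) nzeroB nzero_convex.

Definition nfull : neutrix R :=
  @Neutrix R setT I (fun _ _ _ _ => I) (fun _ _ _ _ _ _ => I).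

Lemma neutrix_total A B : nset A `<=` nset B \/ nset B `<=` nset A.
Proof.
have [|AB] := pselect (nset A `<=` nset B); [by left|right => y By].
have [x /not_implyP[Ax Bx]] := iffRL (existsNP _) AB.
by apply: neutrix_le Ax _; exact/ltW/(neutrix_lt Bx By).
Qed.

Section Sum.
Variables A B : neutrix R.
Let S : set R := [set x + y | x in nset A & y in nset B].

Fact nadd0 : S 0.
Proof. by exists 0; [exact: neutrix0|exists 0; [exact: neutrix0|rewrite addr0]]. Qed.

Fact naddB x y : S x -> S y -> S (x - y).
Proof.
move=> [a Aa [b Bb <-]] [a' Aa' [b' Bb' <-]].
exists (a - a'); first exact: neutrixB.
by exists (b - b'); [exact: neutrixB|ring].
Qed.

Fact nadd_convex : is_interval S.
Proof.
apply: is_interval_dom; [exact: nadd0|exact: naddB|].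
move=> _ z [x Ax [y By <-]] zxy.
have [AB|BA] := neutrix_total A B.
  exists 0; first exact: neutrix0.
  exists z; last by rewrite add0r.
  by apply: neutrix_le zxy; apply: neutrixD => //; exact: AB.
exists z; last by exists 0; [exact: neutrix0|rewrite addr0].
by apply: neutrix_le zxy; apply: neutrixD => //; exact: BA.
Qed.

Definition nadd : neutrix R := Neutrix nadd0 naddB nadd_convex.
End Sum.

Section Scale.
Variables (a : R) (A : neutrix R).
Let S : set R := [set a * x | x in nset A].

Fact nscale0 : S 0.
Proof. by exists 0; [exact: neutrix0|rewrite mulr0]. Qed.

Fact nscaleB x y : S x -> S y -> S (x - y).
Proof.
move=> [u Au <-] [v Av <-].
by exists (u - v); [exact: neutrixB|rewrite mulrBr].
Qed.

Fact nscale_convex : is_interval S.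
Proof.
apply: is_interval_dom; [exact: nscale0|exact: nscaleB|].
move=> _ z [x Ax <-]; have [->|a0] := eqVneq a 0.
  by rewrite mul0r normr0 normr_le0 => /eqP->; exists 0; [exact: neutrix0|rewrite mulr0].
move=> zax; exists (z / a); last by field.
by apply: neutrix_le Ax _; rewrite normf_div ler_pdivrMr ?normr_gt0 // mulrC -normrM.
Qed.

Definition nscale : neutrix R := Neutrix nscale0 nscaleB nscale_convex.
End Scale.

Section Product.
Variables A B : neutrix R.
Let S : set R := [set x * y | x in nset A & y in nset B].

Fact nmul0 : S 0.
Proof. by exists 0; [exact: neutrix0|exists 0; [exact: neutrix0|rewrite mulr0]]. Qed.

Fact nmul_dom x y : S x -> `|y| <= `|x| -> S y.
Proof.
move=> [u Au [v Bv <-]]; have [->|v0] := eqVneq v 0.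
  by rewrite mulr0 normr0 normr_le0 => /eqP->; exact: nmul0.
move=> yuv; exists (y / v); last by exists v => //; field.
by apply: neutrix_le Au _; rewrite normf_div ler_pdivrMr ?normr_gt0 // -normrM.
Qed.

Fact nmulB x y : S x -> S y -> S (x - y).
Proof.
have Dmax (C : neutrix R) s t : nset C s -> nset C t ->
    nset C (Num.max `|s| `|t|).
  by move=> /neutrix_norm ? /neutrix_norm ?; rewrite /Num.max; case: ifP.
move=> [u Au [v Bv <-]] [u' Au' [v' Bv' <-]].
pose p := Num.max `|u| `|u'|; pose q := Num.max `|v| `|v'|.
have Ap : nset A p by exact: Dmax.
have Bq : nset B q by exact: Dmax.
apply: (@nmul_dom ((p + p) * q)).
  by exists (p + p); [exact: neutrixD|exists q].
have up : `|u| <= p by rewrite le_max lexx.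
have u'p : `|u'| <= p by rewrite le_max lexx orbT.
have vq : `|v| <= q by rewrite le_max lexx.
have v'q : `|v'| <= q by rewrite le_max lexx orbT.
have p0 : 0 <= p := le_trans (normr_ge0 _) up.
have q0 : 0 <= q := le_trans (normr_ge0 _) vq.
rewrite (ger0_norm (mulr_ge0 (addr_ge0 p0 p0) q0)) mulrDl.
by apply: le_trans (ler_normB _ _) _; rewrite !normrM lerD // ler_pM.
Qed.

Fact nmul_convex : is_interval S.
Proof. exact: is_interval_dom nmul0 nmulB nmul_dom. Qed.

Definition nmul : neutrix R := Neutrix nmul0 nmulB nmul_convex.
End Product.

Definition nle A B : bool := `[< nset A `<=` nset B >].

Fact nle_refl : reflexive nle.
Proof. by move=> A; apply/asboolP. Qed.

Fact nle_anti : antisymmetric nle.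
Proof.
move=> A B /andP[/asboolP AB /asboolP BA]; apply: neutrix_inj.
exact/seteqP.
Qed.

Fact nle_trans : transitive nle.
Proof.
by move=> B A C /asboolP AB /asboolP BC; apply/asboolP; exact: subset_trans BC.
Qed.

Fact nle_total : total nle.
Proof.
by move=> A B; apply/orP; case: (neutrix_total A B) => ?;
  [left|right]; exact/asboolP.
Qed.

Fact nle0x A : nle nzero A.
Proof. by apply/asboolP => _ ->; exact: neutrix0. Qed.

Fact nlex1 A : nle A nfull.
Proof. exact/asboolP. Qed.

End NeutrixTheory.

Fact neutrix_display : Order.disp_t. Proof. exact: Order.Disp tt tt. Qed.

HB.instance Definition _ (R : realFieldType) := gen_eqMixin (neutrix R).
HB.instance Definition _ (R : realFieldType) := gen_choiceMixin (neutrix R).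
HB.instance Definition _ (R : realFieldType) :=
  Order.Le_isPOrder.Build neutrix_display (neutrix R)
    (@nle_refl R) (@nle_anti R) (@nle_trans R).
HB.instance Definition _ (R : realFieldType) :=
  Order.POrder_isTotal.Build neutrix_display (neutrix R) (@nle_total R).
HB.instance Definition _ (R : realFieldType) :=
  Order.hasBottom.Build neutrix_display (neutrix R) (@nle0x R).
HB.instance Definition _ (R : realFieldType) :=
  Order.hasTop.Build neutrix_display (neutrix R) (@nlex1 R).

Definition translate (R : realFieldType) (a : R) (A : neutrix R) : set R :=
  [set a + x | x in nset A].

Record external (R : realFieldType) := External {
  eset :> set R;
  externalP : exists a, exists A : neutrix R, eset = translate a A }.

Section ExternalTheory.
Variable R : realFieldType.
Implicit Types (alpha beta gamma : external R) (A B : neutrix R) (a b : R).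

Lemma external_inj alpha beta : eset alpha = eset beta -> alpha = beta.
Proof.
case: alpha beta => [S pS] [T pT] /= eqST; subst T.
by congr External; exact: Prop_irrelevance.
Qed.

Definition extnum a A : external R :=
  External (ex_intro _ a (ex_intro _ A erefl)).

Lemma translateP a A x : translate a A x <-> nset A (x - a).
Proof.
split=> [[y Ay <-]|Ax]; first by rewrite addrAC subrr add0r.
by exists (x - a) => //; rewrite addrCA subrr addr0.
Qed.

Lemma extnum_surj alpha : exists a, exists A, alpha = extnum a A.
Proof.
by case: (externalP alpha) => a [A eA]; exists a, A; exact: external_inj.
Qed.

Lemma translate_neutrix a A b B : translate a A = translate b B -> A = B.
Proof.
move=> eAB; apply: neutrix_inj; apply/seteqP; split=> x.
- have Bba : nset B (a - b).
    by apply/translateP; rewrite -eAB; apply/translateP; rewrite subrr; exact: neutrix0.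
  move=> Ax; have /translateP : translate b B (a + x) by rewrite -eAB; exists x.
  by move=> /neutrixB /(_ Bba); have -> : a + x - b - (a - b) = x by ring.
- have Aba : nset A (b - a).
    by apply/translateP; rewrite eAB; apply/translateP; rewrite subrr; exact: neutrix0.
  move=> Bx; have /translateP : translate a A (b + x) by rewrite eAB; exists x.
  by move=> /neutrixB /(_ Aba); have -> : b + x - a - (b - a) = x by ring.
Qed.

Definition neutrix_part alpha : neutrix R :=
  projT1 (cid (projT2 (cid (externalP alpha)))).

Lemma neutrix_part_extnum a A : neutrix_part (extnum a A) = A.
Proof.
rewrite /neutrix_part; case: cid => b /= bP; case: cid => B /= eB.
by apply/esym/(@translate_neutrix a A b B).
Qed.

Definition zeroless alpha : Prop := ~ eset alpha 0.

Lemma zeroless_extnum a A : zeroless (extnum a A) <-> ~ nset A a.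
Proof.
rewrite /zeroless/= translateP sub0r; split=> h h'; apply: h.
  exact: neutrixN.
by rewrite -[a]opprK; exact: neutrixN.
Qed.

Fact add_external alpha beta : exists a, exists A : neutrix R,
  [set x + y | x in eset alpha & y in eset beta] = translate a A.
Proof.
have [a [A ->]] := extnum_surj alpha; have [b [B ->]] := extnum_surj beta.
exists (a + b), (nadd A B); apply/seteqP; split=> [_ [_ [x Ax <-] [_ [y By <-] <-]]|].
  by exists (x + y); [exists x => //; exists y|ring].
move=> _ [_ [x Ax [y By <-]] <-].
by exists (a + x); [exists x|exists (b + y); [exists y|ring]].
Qed.

Definition ext_add alpha beta : external R := External (add_external alpha beta).

Lemma ext_add_extnum a A b B :
  ext_add (extnum a A) (extnum b B) = extnum (a + b) (nadd A B).
Proof.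
apply: external_inj; apply/seteqP; split=> [_ [_ [x Ax <-] [_ [y By <-] <-]]|].
  by exists (x + y); [exists x => //; exists y|ring].
move=> _ [_ [x Ax [y By <-]] <-].
by exists (a + x); [exists x|exists (b + y); [exists y|ring]].
Qed.

Lemma zeroless_half a A x : ~ nset A a -> nset A x -> `|a| <= 2 * `|a + x|.
Proof.
move=> Aa Ax; have := neutrix_lt Aa (neutrixD Ax Ax).
have -> : x + x = 2 * x by ring.
rewrite normrM normr_nat.
have := ler_normB (a + x) x; rewrite addrK; lra.
Qed.

Lemma neutrix_dbl A x y : nset A x -> `|y| <= 2 * `|x| -> nset A y.
Proof.
move=> Ax yx; apply: neutrix_le (neutrixD Ax Ax) _.
have -> : x + x = 2 * x by ring.
by rewrite normrM normr_nat.
Qed.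

(* (a + A)(b + B) = ab + aB + bA + AB *)
Lemma mul_translate a A b B :
  [set x * y | x in translate a A & y in translate b B] =
  translate (a * b) (nadd (nadd (nscale a B) (nscale b A)) (nmul A B)).
Proof.
have main (A' B' : neutrix R) (a' b' x y u v : R) :
    ~ nset A' a' -> nset A' x -> nset B' y -> nset A' u -> nset B' v ->
    exists2 w, nset B' w &
      (a' + x) * (b' + w) = a' * b' + (a' * y + b' * x + u * v).
  move=> Aa Ax By Au Bv; pose t := a' * y + u * v.
  have a0 : a' != 0 by apply/eqP => a0; apply: Aa; rewrite a0; exact: neutrix0.
  have half := zeroless_half Aa Ax.
  have ax0 : a' + x != 0.
    by rewrite -normr_gt0; have := normr_gt0 a'; rewrite a0; lra.
  have Bt : nset B' (t / a').
    rewrite /t mulrDl mulrAC divff // mul1r; apply: neutrixD => //.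
    apply: neutrix_le Bv _; rewrite mulrAC normrM ler_piMl // normf_div.
    by rewrite ler_pdivrMr ?normr_gt0 // mul1r ltW // (neutrix_lt Aa).
  exists (t / (a' + x)); last by rewrite /t; field.
  apply: neutrix_dbl Bt _; rewrite !normf_div ler_pdivrMr ?normr_gt0 //.
  have -> : 2 * (`|t| / `|a'|) * `|a' + x| = `|t| * (2 * `|a' + x|) / `|a'|.
    by ring.
  by rewrite ler_pdivlMr ?normr_gt0 // ler_wpM2l.
apply/seteqP; split=> [_ [_ [x Ax <-] [_ [y By <-] <-]]|].
  exists (a * y + b * x + x * y); last by ring.
  exists (a * y + b * x); first by exists (a * y); [exists y|exists (b * x); [exists x|]].
  by exists (x * y) => //; exists x => //; exists y.
move=> _ [_ [_ [_ [y By <-] [_ [x Ax <-] <-]] [_ [u Au [v Bv <-]] <-]] <-].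
have [Aa|Aa] := pselect (nset A a); last first.
  have [w Bw e] := main A B a b x y u v Aa Ax By Au Bv.
  by exists (a + x); [exists x|exists (b + w); [exists w|]].
have [Bb|Bb] := pselect (nset B b); last first.
  have [w Aw e] := main B A b a y x v u Bb By Ax Bv Au.
  exists (a + w); first by exists w.
  by exists (b + y); [exists y|rewrite mulrC e; ring].
have ABp s t : nset A s -> nset B t -> nset (nmul A B) (s * t).
  by move=> ? ?; exists s => //; exists t.
have [s As [t Bt st]] : nset (nmul A B) (a * b + (a * y + b * x + u * v)).
  by do !apply: neutrixD; try exact: ABp; rewrite mulrC; exact: ABp.
exists s; first by apply/translateP; exact: neutrixB.
by exists t => //; apply/translateP; exact: neutrixB.
Qed.

Fact mul_external alpha beta : exists a, exists A : neutrix R,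
  [set x * y | x in eset alpha & y in eset beta] = translate a A.
Proof.
have [a [A ->]] := extnum_surj alpha; have [b [B ->]] := extnum_surj beta.
by rewrite /= mul_translate; eexists; eexists.
Qed.

Definition ext_mul alpha beta : external R := External (mul_external alpha beta).

Lemma ext_mul_extnum a A b B : ext_mul (extnum a A) (extnum b B) =
  extnum (a * b) (nadd (nadd (nscale a B) (nscale b A)) (nmul A B)).
Proof. by apply: external_inj; rewrite /= mul_translate. Qed.

(* Only meaningful when [0] is not in [T], as [x / 0 = 0]. *)
Definition quot_set (S T : set R) : set R := [set x / y | x in S & y in T].

Lemma quot_set_neutrix A b B : ~ nset B b ->
  quot_set (nset A) (translate b B) = nset (nscale b^-1 A).
Proof.
move=> Bb; have b0 : b != 0.
  by apply/eqP => b0; apply: Bb; rewrite b0; exact: neutrix0.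
apply/seteqP; split=> [_ [x Ax [_ [y By <-] <-]]|_ [x Ax <-]]; last first.
  exists x => //; exists b; last by rewrite mulrC.
  by exists 0; [exact: neutrix0|rewrite addr0].
have half := zeroless_half Bb By.
have by0 : b + y != 0.
  by rewrite -normr_gt0; have := normr_gt0 b; rewrite b0; lra.
exists (b * (x / (b + y))); last by rewrite mulKf.
apply: neutrix_dbl Ax _; rewrite normrM normf_div mulrA ler_pdivrMr ?normr_gt0 //.
by rewrite [leRHS]mulrAC ler_wpM2r.
Qed.

(* 1 / (a + A) = 1 / a + A / a^2 *)
Lemma inv_translate a A : ~ nset A a ->
  quot_set [set 1] (translate a A) = translate a^-1 (nscale (a ^- 2) A).
Proof.
move=> Aa; have a0 : a != 0.
  by apply/eqP => a0; apply: Aa; rewrite a0; exact: neutrix0.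
have dom z w : `|a| <= 2 * `|z| -> nset A w -> nset A (a * (w / z)).
  move=> az Aw; have z0 : z != 0.
    by rewrite -normr_gt0; have := normr_gt0 a; rewrite a0; lra.
  apply: neutrix_dbl Aw _; rewrite normrM normf_div mulrA ler_pdivrMr ?normr_gt0 //.
  by rewrite [leRHS]mulrAC ler_wpM2r.
apply/seteqP; split=> [_ [_ -> [_ [x Ax <-] <-]]|_ [_ [x Ax <-] <-]].
  have half := zeroless_half Aa Ax.
  have ax0 : a + x != 0.
    by rewrite -normr_gt0; have := normr_gt0 a; rewrite a0; lra.
  exists (a ^- 2 * (a * (- x / (a + x)))); last by field; rewrite ax0 a0.
  by exists (a * (- x / (a + x))) => //; apply: dom => //; exact: neutrixN.
have half := zeroless_half Aa Ax.
have ax0 : a + x != 0.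
  by rewrite -normr_gt0; have := normr_gt0 a; rewrite a0; lra.
exists 1 => //; exists (a + a * (- x / (a + x))); last first.
  field; rewrite a0 ax0 /=; have -> : a * (a + x) + a * - x = a * a by ring.
  by rewrite mulf_neq0.
by exists (a * (- x / (a + x))) => //; apply: dom => //; exact: neutrixN.
Qed.

Fact quot_external alpha : zeroless alpha ->
  exists A : neutrix R, nset A = quot_set (nset (neutrix_part alpha)) (eset alpha).
Proof.
have [a [A ->]] := extnum_surj alpha => /zeroless_extnum Aa.
by rewrite neutrix_part_extnum /= quot_set_neutrix //; eexists.
Qed.

Definition relunc alpha : neutrix R :=
  if pselect (zeroless alpha) is left z then projT1 (cid (quot_external z))
  else nfull R.

Lemma relunc_zeroless alpha : zeroless alpha ->
  nset (relunc alpha) = quot_set (nset (neutrix_part alpha)) (eset alpha).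
Proof. by rewrite /relunc; case: pselect => // z _; case: cid. Qed.

Lemma relunc_extnum a A : ~ nset A a -> relunc (extnum a A) = nscale a^-1 A.
Proof.
move=> Aa; apply: neutrix_inj; rewrite relunc_zeroless; last exact/zeroless_extnum.
by rewrite neutrix_part_extnum quot_set_neutrix.
Qed.

Fact ext_addA : associative ext_add.
Proof.
move=> x y z; apply: external_inj; apply/seteqP; split.
  move=> _ [a xa [_ [b yb [c zc <-]] <-]].
  by exists (a + b); [exists a => //; exists b|exists c => //; rewrite addrA].
move=> _ [_ [a xa [b yb <-]] [c zc <-]].
by exists a => //; exists (b + c); [exists b => //; exists c|rewrite addrA].
Qed.

Fact ext_addC : commutative ext_add.
Proof.
move=> x y; apply: external_inj; apply/seteqP.
by split=> _ [a xa [b yb <-]]; exists b => //; exists a => //; rewrite addrC.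
Qed.

Fact ext_add0 : left_id (extnum 0 (nzero R)) ext_add.
Proof.
move=> x; apply: external_inj; apply/seteqP; split.
  by move=> _ [_ [_ -> <-] [b yb <-]]; rewrite addr0 add0r.
move=> b xb; exists 0; last by exists b; rewrite ?add0r.
by exists 0; rewrite ?addr0.
Qed.

End ExternalTheory.

HB.instance Definition _ (R : realFieldType) := gen_eqMixin (external R).
HB.instance Definition _ (R : realFieldType) := gen_choiceMixin (external R).
HB.instance Definition _ (R : realFieldType) :=
  GRing.isNmodule.Build (external R) (@ext_addA R) (@ext_addC R) (@ext_add0 R).

(* External numbers are not a semiring, distributivity fails: the scaling and *)
(* product of matrices are not instances of the library's, unlike their sum.  *)
Definition ext_scalemx (R : realFieldType) (m n : nat) (alpha : external R)
    (A : 'M[external R]_(m, n)) : 'M[external R]_(m, n) :=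
  \matrix_(i, j) ext_mul alpha (A i j).

Definition ext_mulmx (R : realFieldType) (m n p : nat)
    (A : 'M[external R]_(m, n)) (B : 'M[external R]_(n, p)) :
    'M[external R]_(m, p) :=
  \matrix_(i, k) \sum_j ext_mul (A i j) (B j k).

Definition nearly_opposite (R0 : realType) (R : rcfType)
    (st : {rmorphism R0 -> R}) (alpha beta : external R) : Prop :=
  [/\ zeroless alpha, zeroless beta &
      quot_set (eset alpha) (eset beta) `<=`
        [set -1 + x | x in infinitesimals st]].

Definition not_nearly_opposite_mx (R0 : realType) (R : rcfType)
    (st : {rmorphism R0 -> R}) (m n : nat) (A B : 'M[external R]_(m, n)) : Prop :=
  forall i j, ~ nearly_opposite st (A i j) (B i j).

(* Main.v *)
Require Import Defs.
From HB Require Import structures.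
From mathcomp Require Import all_boot all_order all_algebra.
From mathcomp Require Import boolp classical_sets reals.
From mathcomp Require Import ring.

Set Implicit Arguments.
Unset Strict Implicit.
Unset Printing Implicit Defensive.

Import Order.TTheory GRing.Theory Num.Theory.

Local Open Scope ring_scope.

(** All three identities hold entrywise, and each entry (a sum over the inner
    index in the third one, and after commuting the factors in the second one)
    comes down to a single scalar question: when is
    [alpha (beta + gamma) = alpha beta + alpha gamma] for external numbers
    [alpha = a + A], [beta = b + B], [gamma = c + C]?

    Both sides are centred at [a (b + c)], so only their neutrices matter. The
    left one is [(b + c) A + a (B + C) + A (B + C)], the right one is
    [b A + c A + a B + a C + A B + A C]. Neutrices are totally ordered by
    inclusion and their sum is the larger of the two ([nadd_max]), so the two
    neutrices differ only when cancellation in [b + c] makes [(b + c) A] smaller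
    than [b A] and [c A], and this matters only if no other term absorbs the
    loss. As [c = (b + c) - b], it is enough that [b A] be absorbed
    ([ext_mulDr_nscale]).

    If [R(alpha) <= R(beta)], i.e. [A / a <= B / b], multiplying out gives
    [b A <= a B], and a neutrix [beta] gives [b A <= A B] since [b] is in [B]
    ([nscale_le_relunc]); the case [R(alpha) <= R(gamma)] is symmetric.

    If [beta] and [gamma] are not nearly opposite, some quotient
    [(b + x) / (c + y)] stays at an appreciable distance from [-1]. Hence [c] is
    at most a standard multiple of [(b + c) + (x + y)]; neutrices are stable
    under standard multiples, so [c A] is contained in
    [(b + c) A + x A + y A], where [x A <= A B] and [y A <= A C]
    ([ext_mulDr_not_nearly_opposite]). *)

(** * Neutrices under inclusion *)

Section NeutrixOrder.
Variable R : realFieldType.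
Implicit Types (A B C : neutrix R) (a b c x y : R).

Lemma nle_subset A B : (forall x, nset A x -> nset B x) -> (A <= B)%O.
Proof. by move=> AB; apply/asboolP. Qed.

Lemma nle_mem A B x : (A <= B)%O -> nset A x -> nset B x.
Proof. by move=> /asboolP; apply. Qed.

(** By totality one summand contains the other, and being a group it then
    contains the sum. Every inclusion between sums of neutrices thus becomes
    lattice reasoning in a total order. *)
Lemma nadd_max A B : nadd A B = Order.max A B.
Proof.
apply/le_anti/andP; split; last first.
  rewrite ge_max; apply/andP; split; apply: nle_subset => x.
    by exists x => //; exists 0; [exact: neutrix0|rewrite addr0].
  by exists 0; [exact: neutrix0|exists x; rewrite ?add0r].
apply: nle_subset => _ [x Ax [y By <-]].
by apply: neutrixD; [apply: nle_mem Ax|apply: nle_mem By]; rewrite le_max lexx ?orbT.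
Qed.

Lemma le_nscale a : {homo nscale a : A B / (A <= B)%O}.
Proof.
by move=> A B AB; apply: nle_subset => _ [x Ax <-]; exists x => //; exact: nle_mem Ax.
Qed.

Lemma le_nmul A : {homo nmul A : B C / (B <= C)%O}.
Proof.
move=> B C BC; apply: nle_subset => _ [x Ax [y By <-]].
by exists x => //; exists y => //; exact: nle_mem By.
Qed.

Lemma nscale_max a A B :
  nscale a (Order.max A B) = Order.max (nscale a A) (nscale a B).
Proof.
by have [AB|/ltW BA] := leP A B; [rewrite max_r|rewrite max_l] => //; exact: le_nscale.
Qed.

Lemma nmul_max A B C :
  nmul A (Order.max B C) = Order.max (nmul A B) (nmul A C).
Proof.
by have [BC|/ltW CB] := leP B C; [rewrite max_r|rewrite max_l] => //; exact: le_nmul.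
Qed.

Lemma nscaleD_le a b A :
  (nscale (a + b) A <= Order.max (nscale a A) (nscale b A))%O.
Proof.
rewrite -nadd_max; apply: nle_subset => _ [x Ax <-].
by exists (a * x); [exists x|exists (b * x); [exists x|rewrite mulrDl]].
Qed.

Lemma nscaleN a A : nscale (- a) A = nscale a A.
Proof.
by apply/le_anti/andP; split; apply: nle_subset => _ [x Ax <-];
  exists (- x); [exact: neutrixN|ring|exact: neutrixN|ring].
Qed.

Lemma nscale_nmul_le b A B : nset B b -> (nscale b A <= nmul A B)%O.
Proof.
by move=> Bb; apply: nle_subset => _ [x Ax <-]; exists x => //; exists b; rewrite // mulrC.
Qed.

(** A subgroup absorbs multiplication by standard integers, and a convex one
    everything below; the bound [k] must be standard, as the induction shows. *)
Lemma neutrix_limited A x y k : nset A x -> `|y| <= k%:R * `|x| -> nset A y.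
Proof.
move=> Ax; have Akx : nset A (x *+ k).
  by elim: k => [|k IHk]; [exact: neutrix0|rewrite mulrS; exact: neutrixD].
by move=> yx; apply: neutrix_le Akx _; rewrite normrMn -mulr_natl.
Qed.

Lemma nscale_limited a b A k : `|a| <= k%:R * `|b| -> (nscale a A <= nscale b A)%O.
Proof.
move=> ab; apply: nle_subset => _ [x Ax <-].
have [b0|b0] := eqVneq b 0.
  move: ab; rewrite b0 normr0 mulr0 normr_le0 => /eqP->; rewrite mul0r.
  exact: neutrix0.
exists (a * x / b); last by field.
apply: (neutrix_limited (k := k)) Ax _.
rewrite normf_div normrM ler_pdivrMr ?normr_gt0 //.
by rewrite mulrAC ler_wpM2r.
Qed.

End NeutrixOrder.

(** * Reduction to the neutrix parts, and small relative uncertainty *)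

Section Distributivity.
Variable R : realFieldType.
Implicit Types (A B C : neutrix R) (a b c x y : R).
Implicit Types (alpha beta gamma : external R).

Lemma ext_mulC : commutative (@ext_mul R).
Proof.
move=> alpha beta; apply: external_inj; apply/seteqP.
by split=> _ [x ax [y By <-]]; exists y => //; exists x => //; rewrite mulrC.
Qed.

Lemma extnumD a A b B :
  extnum a A + extnum b B = extnum (a + b) (nadd A B).
Proof. exact: ext_add_extnum. Qed.

(** The right-hand side of the hypothesis is the neutrix of the left-hand product
    [(a + A) ((b + c) + (B + C))]. The same bound for [c A] follows from
    [c = (b + c) - b], which is why a single summand suffices. *)
Lemma ext_mulDr_nscale a A b B c C :
  (nscale b A <= Order.max (nscale (b + c) A)
     (Order.max (Order.max (nscale a B) (nscale a C))
                (Order.max (nmul A B) (nmul A C))))%O ->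
  ext_mul (extnum a A) (extnum b B + extnum c C) =
  ext_mul (extnum a A) (extnum b B) + ext_mul (extnum a A) (extnum c C).
Proof.
set D := Order.max (Order.max _ _) _ => bA.
have cA : (nscale c A <= Order.max (nscale (b + c) A) D)%O.
  have {1}-> : c = (b + c) + - b by ring.
  by apply: le_trans (nscaleD_le _ _ _) _; rewrite nscaleN ge_max bA le_max lexx.
rewrite !(extnumD, ext_mul_extnum) mulrDr; congr (extnum _ _).
rewrite !nadd_max nscale_max nmul_max.
transitivity (Order.max (nscale (b + c) A) D).
  by apply/le_anti; rewrite !ge_max !le_max !lexx !orbT.
(* The right-hand neutrix, with [b A] and [c A] grouped. *)
transitivity (Order.max (Order.max (nscale b A) (nscale c A)) D); last first.
  by rewrite /D; apply/le_anti; rewrite !ge_max !le_max !lexx !orbT.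
apply/le_anti; rewrite !ge_max bA cA !le_max !lexx !orbT !andbT /=.
by have := nscaleD_le b c A; rewrite le_max => /orP[]->; rewrite ?orbT.
Qed.

Lemma relunc_neutrix a A : nset A a -> relunc (extnum a A) = nfull R.
Proof.
by move=> Aa; rewrite /relunc; case: pselect => // z; have /zeroless_extnum := z.
Qed.

(** When [beta] is zeroless its relative uncertainty [B / b] omits [1], so it is
    not the whole line and bounds only zeroless [alpha]; then [A / a <= B / b]
    gives [b A <= a B]. When [b] lies in [B], [b A] is inside [A B]. *)
Lemma nscale_le_relunc a A b B :
  (relunc (extnum a A) <= relunc (extnum b B))%O ->
  (nscale b A <= Order.max (nscale a B) (nmul A B))%O.
Proof.
have [Bb _|Bb] := pselect (nset B b).
  by rewrite le_max nscale_nmul_le ?orbT.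
have b0 : b != 0 by apply/eqP => b0; apply: Bb; rewrite b0; exact: neutrix0.
rewrite (relunc_extnum Bb); have [Aa|Aa] := pselect (nset A a).
  rewrite relunc_neutrix // => /(nle_mem (x := 1))/(_ I)[x Bx x1].
  by case: Bb; have <- : x = b by rewrite -[x](mulVKf b0) x1 mulr1.
have a0 : a != 0 by apply/eqP => a0; apply: Aa; rewrite a0; exact: neutrix0.
rewrite relunc_extnum // => AB; rewrite le_max; apply/orP; left.
apply: nle_subset => _ [x Ax <-].
have [|y By yx] := @nle_mem _ _ _ (a^-1 * x) AB; first by exists x.
by exists y => //; rewrite -[y](mulVKf b0) yx; field.
Qed.

Lemma ext_mulDr_relunc alpha beta gamma :
  (relunc alpha <= Order.max (relunc beta) (relunc gamma))%O ->
  ext_mul alpha (beta + gamma) = ext_mul alpha beta + ext_mul alpha gamma.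
Proof.
rewrite le_max; wlog: beta gamma / (relunc alpha <= relunc beta)%O.
  move=> IH /orP[ab|ac]; first by apply: IH; rewrite ?ab.
  by rewrite addrC IH ?ac // addrC.
have [[a [A ->]] [b [B ->]]] := (extnum_surj alpha, extnum_surj beta).
have [c [C ->]] := extnum_surj gamma.
move=> /nscale_le_relunc bA _; apply: ext_mulDr_nscale.
apply: le_trans bA _.
by rewrite ge_max !le_max !lexx !orbT.
Qed.

End Distributivity.

(** * Summands that are not nearly opposite *)

Section NotNearlyOpposite.
Variables (R0 : realType) (R : rcfType) (st : {rmorphism R0 -> R}).

(** Nonnegative reals are squares, and ring morphisms preserve squares. *)
Lemma rmorph_rcf_le (x y : R0) : x <= y -> st x <= st y.
Proof.
rewrite -subr_ge0 => xy.
by rewrite -subr_ge0 -rmorphB -(sqr_sqrtr xy) rmorphXn sqr_ge0.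
Qed.

(** The standard reals are archimedean, so standard integers suffice to detect
    that a number is not infinitesimal. *)
Lemma not_infinitesimal (x : R) : ~ infinitesimals st x ->
  exists k : nat, 1 <= k%:R * `|x|.
Proof.
move=> /existsNP[e /not_implyP[e0 /negP]]; rewrite -leNgt => ex.
have [k ek] : exists k : nat, 1 <= k%:R * e.
  exists (Num.truncn e^-1).+1.
  by rewrite -ler_pdivrMr // div1r ltW // truncnS_gt.
exists k; apply: le_trans (ler_wpM2l (ler0n _ k) ex).
by rewrite -(rmorph_nat st) -rmorphM -(rmorph1 st) rmorph_rcf_le.
Qed.

(** If [beta] or [gamma] is a neutrix, its relative uncertainty is the whole line
    and the previous criterion applies. Otherwise a witness in
    [beta / gamma] away from [-1] shows that the cancellation in [b + c] is
    compensated by the uncertainties [B] and [C]. *)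
Lemma ext_mulDr_not_nearly_opposite (alpha beta gamma : external R) :
  ~ nearly_opposite st beta gamma ->
  ext_mul alpha (beta + gamma) = ext_mul alpha beta + ext_mul alpha gamma.
Proof.
have [a [A ->]] := extnum_surj alpha.
have [[b [B ->]] [c [C ->]]] := (extnum_surj beta, extnum_surj gamma).
have [Bb _|Bb] := pselect (nset B b).
  by apply: ext_mulDr_relunc; rewrite (relunc_neutrix Bb) le_max lex1.
have [Cc _|Cc] := pselect (nset C c).
  by apply: ext_mulDr_relunc; rewrite (relunc_neutrix Cc) le_max lex1 orbT.
move=> opp; have /existsNP[_ /not_implyP[[_ [x Bx <-] [_ [y Cy <-] <-]] q]] :
    ~ (quot_set (eset (extnum b B)) (eset (extnum c C)) `<=`
        [set -1 + x | x in infinitesimals st])%classic.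
  by move=> sub; apply: opp; split=> //; exact/zeroless_extnum.
have half := zeroless_half Cc Cy.
have cy0 : c + y != 0.
  apply/eqP => cy0; move: half; rewrite cy0 normr0 mulr0 normr_le0 => /eqP c0.
  by apply: Cc; rewrite c0; exact: neutrix0.
have [|k] := @not_infinitesimal ((b + c + (x + y)) / (c + y)).
  move=> inf; apply: q; exists ((b + c + (x + y)) / (c + y)) => //.
  by field.
rewrite normf_div mulrA ler_pdivlMr ?normr_gt0 // mul1r => qk.
(* The witness bounds the denominator [c], so [c A] is the term to absorb and
   the summands trade places. *)
rewrite addrC [RHS]addrC; apply: ext_mulDr_nscale.
(* The factor [2] is the cost of replacing [c] by [c + y]. *)
have : `|c| <= (2 * k)%:R * `|b + c + (x + y)|.
  by rewrite natrM -mulrA; apply: le_trans half _; rewrite ler_wpM2l.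
move=> /(nscale_limited A) /le_trans; apply.
apply: le_trans (nscaleD_le _ _ _) _; rewrite ge_max [c + b]addrC.
rewrite [X in X && _]le_max lexx /=.
apply: le_trans (nscaleD_le _ _ _) _.
have := nscale_nmul_le A Bx; have := nscale_nmul_le A Cy.
by rewrite ge_max !le_max => -> ->; rewrite !orbT.
Qed.

End NotNearlyOpposite.

(** * Matrices *)

Lemma le_bigmax_entry disp (T : orderType disp) (x : T) m n
    (F : 'I_m -> 'I_n -> T) i j :
  (F i j <= \big[Order.max/x]_(i < m) \big[Order.max/x]_(j < n) F i j)%O.
Proof. exact: le_trans (le_bigmax _ _ j) (le_bigmax _ _ i). Qed.

Lemma bigmin_entry_le disp (T : orderType disp) (x : T) m n
    (F : 'I_m -> 'I_n -> T) i j :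
  (\big[Order.min/x]_(i < m) \big[Order.min/x]_(j < n) F i j <= F i j)%O.
Proof. exact: le_trans (bigmin_le _ i _) (bigmin_le _ j _). Qed.

Theorem theorem3p5 (R0 : realType) (R : rcfType) (st : {rmorphism R0 -> R})
    (hst : has_nonstandard st) (m n p : nat) (alpha beta : external R) :
  [/\ forall A B : 'M[external R]_(m, n),
        (relunc alpha <=
           \big[Order.min/ \top]_(i < m) \big[Order.min/ \top]_(j < n)
             Order.max (relunc (A i j)) (relunc (B i j)))%O \/
        not_nearly_opposite_mx st A B ->
        ext_scalemx alpha (A + B) = ext_scalemx alpha A + ext_scalemx alpha B,
      forall A : 'M[external R]_(m, n),
        (\big[Order.max/ \bot]_(i < m) \big[Order.max/ \bot]_(j < n)
           relunc (A i j) <= Order.max (relunc alpha) (relunc beta))%O \/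
        ~ nearly_opposite st alpha beta ->
        ext_scalemx (alpha + beta) A = ext_scalemx alpha A + ext_scalemx beta A
    & forall (A : 'M[external R]_(m, n)) (B C : 'M[external R]_(n, p)),
        (\big[Order.max/ \bot]_(i < m) \big[Order.max/ \bot]_(j < n)
           relunc (A i j) <=
         \big[Order.min/ \top]_(i < n) \big[Order.min/ \top]_(j < p)
           Order.max (relunc (B i j)) (relunc (C i j)))%O \/
        not_nearly_opposite_mx st B C ->
        ext_mulmx A (B + C) = ext_mulmx A B + ext_mulmx A C].
Proof.
have distr (a b c : external R) :
    (relunc a <= Order.max (relunc b) (relunc c))%O \/ ~ nearly_opposite st b c ->
    ext_mul a (b + c) = ext_mul a b + ext_mul a c.
  by case; [exact: ext_mulDr_relunc|exact: ext_mulDr_not_nearly_opposite].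
split=> [A B h|A h|A B C h].
- apply/matrixP => i j; rewrite !mxE; apply: distr.
  case: h => [h|h]; [left|right; exact: h].
  exact: le_trans h (bigmin_entry_le _ _ i j).
- apply/matrixP => i j; rewrite !mxE ext_mulC distr.
    by rewrite !(ext_mulC (A i j)).
  case: h => [h|h]; [left|right; exact: h].
  exact: le_trans (le_bigmax_entry _ _ i j) h.
- apply/matrixP => i k; rewrite !mxE -big_split /=; apply: eq_bigr => j _.
  rewrite mxE; apply: distr.
  case: h => [h|h]; [left|right; exact: h].
  exact: le_trans (le_trans (le_bigmax_entry _ _ i j) h) (bigmin_entry_le _ _ j k).
Qed.
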